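(* Let $n\ge1$ be odd, $G_{\mathbb R}=SO^*(2n)$, and let $p$ be an even integer with $0\le p\le n-1$. Put $r=\frac p2$ and $s=\frac{n-1-p}2$. Then the constant $c_p^n$ (as defined in the context) for the real form of $\mathcal O^{\mathbb C}$ corresponding to $p$, i.e. to $h=h_p=(\underbrace{1,\dots,1}_{p}\,|\,0;\underbrace{-1,\dots,-1}_{n-1-p})$, is $$c_p^n=(-1)^{\frac p2}\binom{r+s}{r}.$$
   Context: Notation: $\mathfrak g=\mathfrak{so}(2n,\mathbb C)$ with Cartan decomposition $\mathfrak g=\mathfrak k\oplus\mathfrak p$, $\mathfrak k\cong\mathfrak{gl}(n,\mathbb C)$, and $\mathfrak h\subset\mathfrak k$ is a Cartan subalgebra. $\mathfrak h$ and $\mathfrak h^*$ are identified with $\mathbb C^n$ with standard coordinates $\varepsilon_1,\dots,\varepsilon_n$ and standard bilinear form $\langle\ ,\ \rangle$; bars and semicolons in coordinate expressions are only separators. Positive roots: $\Delta^+=\{\varepsilon_i\pm\varepsilon_j\mid i<j\}$. Compact roots: $\pm(\varepsilon_i-\varepsilon_j)$, $i<j$; noncompact roots: $\pm(\varepsilon_i+\varepsilon_j)$, $i<j$. Set $\Delta_c^+=\{\varepsilon_i-\varepsilon_j\mid i<j\}$, $\rho_c$ half their sum, and $$P_K(\lambda)=\prod_{\alpha\in\Delta_c^+}\frac{\langle\lambda,\alpha\rangle}{\langle\rho_c,\alpha\rangle}.$$ $\mathcal O^{\mathbb C}$ is the complex nilpotent orbit with partition $[2^{n-1},1^2]$; its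 real forms are nilpotent $K$-orbits in $\mathfrak p$ (where $K$ is the complexification of the maximal compact subgroup), and $h$ is the semisimple element of the $\mathfrak{sl}_2$-triple of the real form. Definition of the constant attached to $h$. Let $\mathfrak l$ be the centralizer of $h$ in $\mathfrak g$, $\Delta(\mathfrak l)=\{\alpha\mid\alpha(h)=0\}$ its roots, $\Delta^+(\mathfrak l)=\Delta(\mathfrak l)\cap\Delta^+$, and $\Delta_n^+(\mathfrak l)$ the set of noncompact roots in $\Delta^+(\mathfrak l)$, with half sum $\rho_n(\mathfrak l)$. $P_{L\cap K}$ is the Weyl dimension polynomial of $\mathfrak l\cap\mathfrak k$, i.e. $P_{L\cap K}(\lambda)=\prod\langle\lambda,\alpha\rangle/\langle\rho_{\mathfrak l\cap\mathfrak k},\alpha\rangle$, the product over compact $\alpha\in\Delta^+(\mathfrak l)$ and $\rho_{\mathfrak l\cap\mathfrak k}$ being half the sum of these roots. Let $\Delta(\mathfrak p_1)$ be the set of noncompact roots $\alpha$ with $\alpha(h)=1$, let $N=\#\{\alpha\in\Delta^+\mid\alpha(h)>0\}$, and for a set $A$ of roots let $\rho(A)$ be half the sum of its elements. The constant $c=c(h)$ is defined by the polynomial identity in $\lambda\in\mathfrak h^*$ $$(-1)^N\sum_{A\subseteq\Delta_n^+(\mathfrak l),\ C\subseteq\Delta(\mathfrak p_1)}(-1)^{\#A+\#C}P_K(\lambda-\rho_n(\mathfrak l)+2\rho(A)-2\rho(C))=c\,P_{L\cap K}(\lambda);$$ it is known from earlier work that the left side is a constant multiple of $P_{L\cap K}$.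 *)

(* Defs.v *)
(* The complex field is the MathComp type R[i], for R : realType. *)
From mathcomp Require Import all_boot all_order all_algebra.
From mathcomp Require Import reals complex.

Set Implicit Arguments.
Unset Strict Implicit.
Unset Printing Implicit Defensive.

Import Order.TTheory GRing.Theory Num.Theory.
Local Open Scope ring_scope.
Local Open Scope complex_scope.

(* Both h and its dual are identified with C^n, coordinates counted from 0. *)

(* The standard bilinear form; no complex conjugation is involved. *)
Definition dotC (R : realType) (n : nat) (x y : 'rV[R[i]]_n) : R[i] :=
  \sum_(k < n) x 0 k * y 0 k.

Definition eps (R : realType) (n : nat) (k : 'I_n) : 'rV[R[i]]_n :=
  delta_mx 0 k.

(* Labels for the roots of so(2n): on the set [roots n] below, the label
   (i, j, m, t) (with i < j) stands for the root
     (-1)^t * (eps_i + (-1)^m * eps_j),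
   so m = true gives +-(eps_i - eps_j), m = false gives +-(eps_i + eps_j), and
   t = true marks the negative roots. *)
Definition rlabel (n : nat) : finType := ('I_n * 'I_n * bool * bool)%type.

Definition rootv (R : realType) (n : nat) (a : rlabel n) : 'rV[R[i]]_n :=
  let: (i, j, m, t) := a in (-1) ^+ t *: (eps R i + (-1) ^+ m *: eps R j).

Definition roots (n : nat) : {set rlabel n} :=
  [set a : rlabel n | let: (i, j, _, _) := a in (i < j)%N].

Definition is_pos (n : nat) (a : rlabel n) : bool :=
  let: (_, _, _, t) := a in ~~ t.

Definition is_compact (n : nat) (a : rlabel n) : bool :=
  let: (_, _, m, _) := a in m.

Definition pos_roots (n : nat) : {set rlabel n} :=
  [set a in roots n | is_pos a].

Definition pos_compact_roots (n : nat) : {set rlabel n} :=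
  [set a in pos_roots n | is_compact a].

(* Distinct labels of roots give distinct roots, so that sums over sets of
   labels and cardinals of such sets are those of the sets of roots. *)
Lemma rootv_inj (R : realType) (n : nat) :
  {in roots n &, injective (@rootv R n)}.
Proof.
have two1 (b c : bool) : ((-1) ^+ b == (-1) ^+ c :> R[i]) = (b == c).
  have N : (1 == -1 :> R[i]) = false.
    by rewrite -subr_eq0 opprK -(natrD _ 1 1) pnatr_eq0.
  by case: b; case: c; rewrite ?expr0 ?expr1 ?eqxx // eq_sym.
have nz (b : bool) : (-1) ^+ b != 0 :> R[i] by rewrite signr_eq0.
have E (i j : 'I_n) m t (k : 'I_n) : (i < j)%N ->
    rootv R (i, j, m, t) 0 k =
      if k == i then (-1) ^+ t else
      if k == j then (-1) ^+ t * (-1) ^+ m else 0.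
  move=> ij; rewrite /rootv !mxE eqxx /=.
  have [->|ki] := eqVneq k i; last by rewrite add0r; case: eqP => _;
    rewrite ?mulr1 ?mulr0.
  by rewrite -val_eqE /= ltn_eqF // mulr0 addr0 mulr1.
move=> [[[i j] m] t] [[[i' j'] m'] t']; rewrite !inE => ij ij' eqv.
have e k : rootv R (i, j, m, t) 0 k = rootv R (i', j', m', t') 0 k.
  by rewrite eqv.
have memb (k : 'I_n) : (k == i) || (k == j) = (k == i') || (k == j').
  have nzE (a b : 'I_n) u v : (a < b)%N ->
      (rootv R (a, b, u, v) 0 k != 0) = (k == a) || (k == b).
    move=> ab; rewrite E //; case: (k =P a) => _ /=; first by rewrite nz.
    by case: (k =P b) => _; rewrite ?eqxx // mulf_neq0.
  by rewrite -(nzE i j m t ij) -(nzE i' j' m' t' ij') e.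
have [ii jj] : i = i' /\ j = j'.
  have := memb i; have := memb j; have := memb i'; have := memb j'.
  rewrite !eqxx !orbT /= => /orP H1 /orP H2 /esym/orP H3 /esym/orP H4.
  case: H4 => /eqP H4; case: H3 => /eqP H3; subst; rewrite ?ltnn // in ij *.
  by move: (ltn_trans ij ij'); rewrite ltnn.
subst i' j'.
have tt : t = t'.
  by have := e i; rewrite !E // eqxx => /eqP; rewrite two1 => /eqP.
subst t'.
have := e j; rewrite !E // eqxx -val_eqE /= (gtn_eqF ij).
by move/(mulfI (nz t))/eqP; rewrite two1 => /eqP ->.
Qed.

Definition rho (R : realType) (n : nat) (A : {set rlabel n}) : 'rV[R[i]]_n :=
  2^-1 *: \sum_(a in A) rootv R a.

(* The Weyl dimension polynomial of the positive system D. *)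
Definition weyl_poly (R : realType) (n : nat) (D : {set rlabel n})
    (lam : 'rV[R[i]]_n) : R[i] :=
  \prod_(a in D) (dotC lam (rootv R a) / dotC (rho R D) (rootv R a)).

Definition P_K (R : realType) (n : nat) (lam : 'rV[R[i]]_n) : R[i] :=
  weyl_poly (pos_compact_roots n) lam.

Section ConstantOfH.
Variables (R : realType) (n : nat) (h : 'rV[R[i]]_n).

Definition l_pos_roots : {set rlabel n} :=
  [set a in pos_roots n | dotC (rootv R a) h == 0].

Definition l_pos_noncompact_roots : {set rlabel n} :=
  [set a in l_pos_roots | ~~ is_compact a].

Definition l_pos_compact_roots : {set rlabel n} :=
  [set a in l_pos_roots | is_compact a].

Definition P_LK (lam : 'rV[R[i]]_n) : R[i] :=
  weyl_poly l_pos_compact_roots lam.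

Definition p1_roots : {set rlabel n} :=
  [set a in roots n | ~~ is_compact a & dotC (rootv R a) h == 1].

(* In R[i], [0 < z] means that z is real and positive. *)
Definition N_h : nat := #|[set a in pos_roots n | 0 < dotC (rootv R a) h]|.

Definition alternating_sum (lam : 'rV[R[i]]_n) : R[i] :=
  (-1) ^+ N_h *
  \sum_(A : {set rlabel n} | A \subset l_pos_noncompact_roots)
    \sum_(C : {set rlabel n} | C \subset p1_roots)
      (-1) ^+ (#|A| + #|C|) *
      P_K (lam - rho R l_pos_noncompact_roots + 2 *: rho R A - 2 *: rho R C).

Definition is_constant_of (c : R[i]) : Prop :=
  forall lam : 'rV[R[i]]_n, alternating_sum lam = c * P_LK lam.

End ConstantOfH.

(* (1, ..., 1 | 0; -1, ..., -1), with p entries 1 and n - 1 - p entries -1. *)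
Definition h_p (R : realType) (n p : nat) : 'rV[R[i]]_n :=
  \row_(k < n) if (k < p)%N then 1 else if k == p :> nat then 0 else -1.

(* Main.v *)
(* Write V for the Vandermonde product and T_v for translation by v. Up to
   constants and a translation that is constant on the three blocks of
   coordinates of h (those with value 1, 0, -1), the alternating sum is G V,
   where G is the product of the operators 1 - T_(eps_i + eps_j) over the pairs
   (i, j) in different blocks.

   G V is a multiple of the product V_b of the inner differences of the blocks:
   every factor of G lowers the degree by one, so G V has at most the degree of
   V_b, and it is antisymmetric under the permutations that preserve the blocks.

   The multiple is found at the point x whose coordinates run through 0, 1, ...
   in each block. All translates of x occurring in (G V)(x) have coordinates
   between 0 and n - 1; read as exponents, they show that
   (G V)(x) / V(0, ..., n - 1) = A(z) / V(z) for every z, where A is the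
   antisymmetrisation of z^x * prod (1 - z_i z_j). Take z symmetric under
   inversion. A permutation then contributes to A(z) only if it puts z_i and
   1 / z_i into the same block, for every i. The permutations inducing a given
   colouring of z by the blocks contribute V(z) together, and such a colouring
   amounts to the choice of r of the r + s pairs {z_i, 1 / z_i}. *)
Require Import Defs.
From mathcomp Require Import all_boot all_order all_algebra all_fingroup.
From mathcomp Require Import reals complex zify ring.

Set Implicit Arguments.
Unset Strict Implicit.
Unset Printing Implicit Defensive.

Import Order.TTheory GRing.Theory Num.Theory.
Local Open Scope ring_scope.

(** * Alternating sums over subsets and products of difference operators *)

Lemma set_ind (I : finType) (P : {set I} -> Prop) :
  P set0 -> (forall a (D : {set I}), a \notin D -> P D -> P (a |: D)) -> forall D, P D.
Proof.
move=> P0 PS D; have [k] := ubnP #|D|; elim: k D => // k IH D.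
have [->//|[a aD]] := set_0Vmem D; rewrite (cardsD1 a) aD ltnS => lek.
by rewrite -(setD1K aD); apply: PS; [rewrite !inE eqxx | apply: IH].
Qed.

Lemma sum_subsets_setU1 (V : nmodType) (I : finType) (a : I) (D : {set I})
    (f : {set I} -> V) : a \notin D ->
  \sum_(A : {set I} | A \subset a |: D) f A =
  \sum_(A : {set I} | A \subset D) (f A + f (a |: A)).
Proof.
move=> aD; rewrite big_split /= (bigID (fun A : {set I} => a \notin A)) /=.
congr (_ + _).
  apply: eq_bigl => A; apply/andP/idP => [[/subsetP sA aA]|/subsetP sA].
    apply/subsetP => x xA; have := sA x xA; rewrite !inE.
    by case/orP => // /eqP xa; rewrite -xa xA in aA.
  split; first by apply/subsetP => x /sA xD; rewrite !inE xD orbT.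
  by apply: contra aD => /sA.
rewrite (reindex_onto (fun A => a |: A) (fun A => A :\ a)) /=; last first.
  by move=> A /andP[_]; rewrite negbK => /setD1K.
apply: eq_bigl => A; apply/andP/idP => [[/andP[/subsetP sA _] /eqP eA]|sA].
  apply/subsetP => x xA; have /sA : x \in a |: A by rewrite !inE xA orbT.
  rewrite !inE => /orP[/eqP xa|//]; move: xA.
  by rewrite -eA !inE xa eqxx.
rewrite setUS //= negbK setU11; split=> //; apply/eqP/setU1K.
by apply: contra aD => /(subsetP sA).
Qed.

Section Differences.
Variables (F : pzRingType) (W : zmodType).
Implicit Types (f : W -> F) (x : W).

(* The operator [\prod_(a in D) (1 - T_(v a))], where [T_w f x = f (x + w)]. *)
Definition diff_op (I : finType) (D : {set I}) (v : I -> W) f x : F :=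
  \sum_(A : {set I} | A \subset D) (-1) ^+ #|A| * f (x + \sum_(a in A) v a).

Lemma diff_op0 (I : finType) (v : I -> W) f x : diff_op set0 v f x = f x.
Proof.
rewrite /diff_op (big_pred1 set0) => [|A]; last by rewrite subset0.
by rewrite cards0 mul1r big_set0 addr0.
Qed.

Lemma diff_opU1 (I : finType) (a : I) (D : {set I}) (v : I -> W) f x :
  a \notin D ->
  diff_op (a |: D) v f x = diff_op D v f x - diff_op D v f (x + v a).
Proof.
move=> aD; rewrite /diff_op sum_subsets_setU1 // big_split /= -sumrN.
congr (_ + _); apply: eq_bigr => A sA.
have aA : a \notin A by apply: contra aD => /(subsetP sA).
by rewrite cardsU1 aA exprS mulN1r mulNr big_setU1 // addrA.
Qed.

Lemma eq_diff_op (I : finType) (D : {set I}) (v v' : I -> W) f f' x :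
  {in D, v =1 v'} -> f =1 f' -> diff_op D v f x = diff_op D v' f' x.
Proof.
move=> vv ff; apply: eq_bigr => A sA; rewrite ff.
congr (_ * f' (_ + _)); apply: eq_bigr => a aA; apply: vv.
exact: (subsetP sA).
Qed.

(** Factor by factor, [1 - T_(-v) = - T_(-v) (1 - T_v)]: negative translations are traded for
    positive ones at the cost of a sign and one overall shift. *)
Lemma diff_opN (I : finType) (D : {set I}) (v : I -> W) f x :
  diff_op D (fun a => - v a) f x =
  (-1) ^+ #|D| * diff_op D v f (x - \sum_(a in D) v a).
Proof.
elim/set_ind: D x => [|a D aD IH] x.
  by rewrite !diff_op0 big_set0 subr0 cards0 mul1r.
rewrite !diff_opU1 // !IH cardsU1 aD exprS big_setU1 //= mulN1r mulNr.
have -> : x - v a - \sum_(b in D) v b = x - (v a + \sum_(b in D) v b).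
  by rewrite opprD addrA.
have -> : x - (v a + \sum_(b in D) v b) + v a = x - \sum_(b in D) v b.
  by rewrite opprD addrA addrAC subrK.
by rewrite mulrBr opprB.
Qed.

Lemma diff_opU (I : finType) (D1 D2 : {set I}) (v : I -> W) f x :
  [disjoint D1 & D2] ->
  diff_op (D1 :|: D2) v f x = diff_op D1 v (diff_op D2 v f) x.
Proof.
elim/set_ind: D1 x => [|a D aD IH] x dis; first by rewrite set0U diff_op0.
have [aD2 {}dis] : a \notin D2 /\ [disjoint D & D2].
  by move: dis; rewrite !disjoints_subset subUset sub1set inE => /andP.
by rewrite -setUA !diff_opU1 ?IH // !inE negb_or aD.
Qed.

Lemma diff_op_imset (I J : finType) (g : I -> J) (D : {set I}) (v : J -> W)
    f x :
  injective g -> diff_op (g @: D) v f x = diff_op D (v \o g) f x.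
Proof.
move=> gI; elim/set_ind: D x => [|a D aD IH] x.
  by rewrite imset0 !diff_op0.
by rewrite imsetU1 !diff_opU1 ?mem_imset // !IH.
Qed.

Lemma diff_op_scale (I : finType) (D : {set I}) (v : I -> W) f c x :
  diff_op D v (fun y => f y * c) x = diff_op D v f x * c.
Proof. by rewrite mulr_suml; apply: eq_bigr => A _; rewrite mulrA. Qed.

End Differences.

Lemma prod_one_sub (R : comPzRingType) (I : finType) (D : {set I}) (g : I -> R) :
  \prod_(a in D) (1 - g a) =
  \sum_(A : {set I} | A \subset D) (-1) ^+ #|A| * \prod_(a in A) g a.
Proof.
elim/set_ind: D => [|a D aD IH].
  rewrite big_set0 (big_pred1 set0) => [|A]; last by rewrite subset0.
  by rewrite cards0 big_set0 mul1r.
rewrite big_setU1 //= sum_subsets_setU1 // IH mulr_sumr; apply: eq_bigr => A sA.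
have aA : a \notin A by apply: contra aD => /(subsetP sA).
by rewrite cardsU1 aA exprS mulN1r mulNr big_setU1 //=; ring.
Qed.

(** * Polynomial functions of bounded degree *)

Section PolynomialFunctions.
Variables (F : comPzRingType) (n : nat).

(** The index is an upper bound for the total degree; [pdeg_ext] takes the place of function
    extensionality. *)
Inductive pdeg : nat -> ('rV[F]_n -> F) -> Prop :=
| pdeg_const d c : pdeg d (fun=> c)
| pdeg_coord d k f : pdeg d f -> pdeg d.+1 (fun x => x 0 k * f x)
| pdeg_add d f g : pdeg d f -> pdeg d g -> pdeg d (fun x => f x + g x)
| pdeg_ext d f g : f =1 g -> pdeg d f -> pdeg d g.

Lemma pdeg_scale d c f : pdeg d f -> pdeg d (fun x => c * f x).
Proof.
elim=> {d f} [d a|d k f _ IH|d f g _ IHf _ IHg|d f g fg _ IH].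
- exact: pdeg_const.
- by apply: pdeg_ext (pdeg_coord k IH) => x; rewrite mulrCA.
- by apply: pdeg_ext (pdeg_add IHf IHg) => x; rewrite mulrDr.
- by apply: pdeg_ext IH => x; rewrite fg.
Qed.

Lemma pdeg_coordB d i j f :
  pdeg d f -> pdeg d.+1 (fun x => (x 0 j - x 0 i) * f x).
Proof.
move=> Hf; apply: pdeg_ext
  (pdeg_add (pdeg_coord j Hf) (pdeg_scale (-1) (pdeg_coord i Hf))) => x.
by rewrite mulN1r mulrBl.
Qed.

Lemma pdeg_translate d (v : 'rV[F]_n) f : pdeg d f -> pdeg d (fun x =>
  f (x + v)).
Proof.
elim=> {d f} [d a|d k f Hf IH|d f g _ IHf _ IHg|d f g fg _ IH].
- exact: pdeg_const.
- have wk : forall d' g, pdeg d' g -> pdeg d'.+1 g.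
    move=> d' g; elim=> {d' g} [d' a|d' k' g _ IH'|d' g g' _ H1 _ H2|d' g g' e _ H].
    + exact: pdeg_const.
    + exact: pdeg_coord.
    + exact: pdeg_add.
    + exact: pdeg_ext e H.
  apply: pdeg_ext (pdeg_add (pdeg_coord k IH)
    (pdeg_scale (v 0 k) (wk _ _ IH))) => x.
  by rewrite mxE mulrDl.
- exact: pdeg_add.
- by apply: pdeg_ext IH => x.
Qed.

(** By the discrete Leibniz rule the difference of [x 0 k * f x] is [x 0 k] times the difference of
    [f], minus [v 0 k * f (x + v)]. Degree 0 is the base case: there the difference is zero. *)
Lemma pdeg_diff d (v : 'rV[F]_n) f : pdeg d f ->
  if d is d'.+1 then pdeg d' (fun x => f x - f (x + v))
  else forall x, f x - f (x + v) = 0.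
Proof.
elim=> {d f} [d a|d k f Hf IH|d f g _ IHf _ IHg|d f g fg _ IH].
- case: d => [x|d]; first by rewrite subrr.
  by apply: pdeg_ext (pdeg_const d 0) => x; rewrite subrr.
- have Hv : pdeg d (fun x => - v 0 k * f (x + v)).
    exact: pdeg_scale (pdeg_translate v Hf).
  have E (x : 'rV[F]_n) : x 0 k * f x - (x + v) 0 k * f (x + v) =
      x 0 k * (f x - f (x + v)) + - v 0 k * f (x + v).
    by rewrite mxE; ring.
  case: d Hf IH Hv => [|d] Hf IH Hv.
    by apply: pdeg_ext Hv => x; rewrite E IH mulr0 add0r.
  by apply: pdeg_ext (pdeg_add (pdeg_coord k IH) Hv) => x; rewrite E.
- have E (x : 'rV[F]_n) : f x + g x - (f (x + v) + g (x + v)) =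
      (f x - f (x + v)) + (g x - g (x + v)) by ring.
  case: d IHf IHg => [|d] IHf IHg; first by move=> x; rewrite E IHf IHg addr0.
  by apply: pdeg_ext (pdeg_add IHf IHg) => x; rewrite E.
- case: d IH => [|d] IH; first by move=> x; rewrite -!fg.
  by apply: pdeg_ext IH => x; rewrite !fg.
Qed.

Lemma pdeg_diff_op (I : finType) (D : {set I}) (v : I -> 'rV[F]_n) d f :
  pdeg (#|D| + d) f -> pdeg d (diff_op D v f).
Proof.
elim/set_ind: D d => [|a D aD IH] d.
  by rewrite cards0 => /pdeg_ext; apply=> x; rewrite diff_op0.
rewrite cardsU1 aD addSnnS => /IH /(pdeg_diff (v a)) /pdeg_ext; apply=> x.
by rewrite diff_opU1.
Qed.

End PolynomialFunctions.

(** * Exponent sums and Vandermonde determinants *)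

Lemma uniq_sumn_ge (s : seq nat) : uniq s ->
  ('C(size s, 2) <= sumn s)%N /\
  ((sumn s <= 'C(size s, 2))%N -> {in s, forall a, (a < size s)%N}).
Proof.
have [k] := ubnP (size s); elim: k s => // k IH s; rewrite ltnS => szs us.
have [->//|s0] := eqVneq s [::].
(* The maximum [M] is removed. Distinctness gives [M >= size s - 1], hence the lower bound; if the
   total is minimal, [M] is no larger than that, and it bounds all entries. *)
have [M Ms maxM] : exists2 M, M \in s & {in s, forall a, (a <= M)%N}.
  elim: s s0 {szs us} => // a [|b s] IHs _.
    by exists a => [|b]; rewrite !inE // => /eqP ->.
  have [//|M Ms maxM] := IHs; case: (leqP a M) => aM.
    by exists M => [|c]; rewrite inE ?Ms ?orbT // => /predU1P[->|/maxM].
  exists a => [|c]; first exact: mem_head.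
  by rewrite inE => /predU1P[->//|/maxM cM]; apply: leq_trans cM (ltnW aM).
have szM : ((size s).-1 <= M)%N.
  have : (size s <= size (iota 0 M.+1))%N.
    by apply: uniq_leq_size => // a /maxM; rewrite mem_iota.
  by rewrite size_iota; case: (size s).
have rs : size (rem M s) = (size s).-1 by rewrite size_rem.
have s1 : (0 < size s)%N by rewrite lt0n size_eq0.
have [|lo _] := IH (rem M s) _ (rem_uniq M us).
  by rewrite rs; case: (size s) s1 szs.
have -> : sumn s = (M + sumn (rem M s))%N.
  by rewrite !sumnE (perm_big _ (perm_to_rem Ms)) big_cons.
move: lo; rewrite rs; case: (size s) s1 szM => // m _ /= szM lo.
rewrite binS bin1; split; first by rewrite addnC leq_add.
move=> le a /maxM aM; rewrite ltnS (leq_trans aM) //.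
by rewrite -(leq_add2r (sumn (rem M s))) (leq_trans le) // addnC leq_add2l.
Qed.

Section Vandermonde.
Variable F : numFieldType.

Definition vdm n (x : 'rV[F]_n) : F :=
  \prod_(e : 'I_n * 'I_n | (e.1 < e.2)%N) (x 0 e.2 - x 0 e.1).

(** The alternant matrix: its determinant is the antisymmetrised monomial with exponents [e]. *)
Definition powmx n (x : 'rV[F]_n) (e : 'I_n -> nat) : 'M[F]_n :=
  \matrix_(i, j) x 0 i ^+ e j.

Definition nat_row n (e : 'I_n -> nat) : 'rV[F]_n := \row_j (e j)%:R.

Lemma vdm_prod n (x : 'rV[F]_n) :
  \prod_(i < n) \prod_(j < n | (i < j)%N) (x 0 j - x 0 i) = vdm x.
Proof. by rewrite pair_big_dep. Qed.

Lemma vdmE n (x : 'rV[F]_n) : vdm x = \det (powmx x val).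
Proof.
rewrite -det_tr (_ : _^T = Vandermonde n x); last first.
  by apply/matrixP => i j; rewrite !mxE.
by rewrite det_Vandermonde vdm_prod.
Qed.

Lemma det_col_perm n (s : 'S_n) (A : 'M[F]_n) :
  \det (col_perm s A) = (-1) ^+ s * \det A.
Proof. by rewrite col_permE det_mulmx det_perm odd_permV mulrC. Qed.

Lemma vdm_perm n (s : 'S_n) (x : 'rV[F]_n) :
  vdm (col_perm s x) = (-1) ^+ s * vdm x.
Proof.
rewrite !vdmE -[\det (powmx x _)]det_tr -det_col_perm -det_tr; congr (\det _).
by apply/matrixP => i j; rewrite !mxE.
Qed.

Lemma vdm_neq0 n (x : 'rV[F]_n) : injective (x 0) -> vdm x != 0.
Proof.
move=> xI; apply/prodf_neq0 => -[i j] /= ij.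
by rewrite subr_eq0 (inj_eq xI) -val_eqE /= gtn_eqF.
Qed.

Lemma det_powmx_eq0 n (x : 'rV[F]_n) (e : 'I_n -> nat) j k :
  j != k -> e j = e k -> \det (powmx x e) = 0.
Proof.
move=> jk ejk; rewrite -det_tr; apply: (determinant_alternate jk) => i.
by rewrite !mxE ejk.
Qed.

(* Both sides are alternating in [e], and they agree when [e] is the identity. *)
Lemma det_powmx n (x : 'rV[F]_n) (e : 'I_n -> nat) :
  (forall j, (e j < n)%N) ->
  \det (powmx x e) * vdm (nat_row (@nat_of_ord n)) = vdm x * vdm (nat_row e).
Proof.
move=> en; pose g j := Ordinal (en j).
have [/injectiveP gI|/injectivePn[j [k jk gjk]]] := boolP (injectiveb g).
  have -> : powmx x e = col_perm (perm gI) (powmx x val).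
    by apply/matrixP => i j; rewrite !mxE permE.
  have -> : nat_row e = col_perm (perm gI) (nat_row (@nat_of_ord n)).
    by apply/matrixP => i j; rewrite !mxE permE.
  by rewrite vdm_perm det_col_perm -vdmE -mulrA [RHS]mulrCA.
have ejk : e j = e k by have := congr1 val gjk.
rewrite (det_powmx_eq0 _ jk ejk) mul0r [vdm (nat_row e)]vdmE.
rewrite (determinant_alternate jk) ?mulr0 // => i.
by rewrite !mxE ejk.
Qed.

Lemma vdm_nat_neq0 n (e : 'I_n -> nat) : injective e -> vdm (nat_row e) != 0.
Proof.
move=> eI; apply: vdm_neq0 => i j; rewrite !mxE => /eqP.
by rewrite eqr_nat => /eqP /eI.
Qed.

(** Equal exponents give equal columns; distinct ones of minimal sum rearrange [0, ..., n - 1]. The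
    lower bound is part of the conclusion because, with two blocks, it limits the degree left for
    the other block. *)
Lemma det_powmx_low_degree n (e : 'I_n -> nat) :
  (forall x : 'rV[F]_n, \det (powmx x e) = 0) \/
  ('C(n, 2) <= \sum_j e j)%N /\
  ((\sum_j e j <= 'C(n, 2))%N ->
   exists k, forall x : 'rV[F]_n, \det (powmx x e) = k * vdm x).
Proof.
have [/injectiveP eI|/injectivePn[j [k jk ejk]]] := boolP (injectiveb e);
  last by left=> x; apply: det_powmx_eq0 jk ejk.
right; have [] := @uniq_sumn_ge (map e (enum 'I_n)).
  by rewrite map_inj_uniq ?enum_uniq.
rewrite size_map size_enum_ord sumnE big_map big_enum /= => lo hi.
split=> // le; exists (vdm (nat_row e) / vdm (nat_row (@nat_of_ord n))) => x.
have en j : (e j < n)%N by apply: hi => //; apply/map_f/mem_enum.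
have nz : vdm (nat_row (@nat_of_ord n)) != 0.
  by apply: vdm_nat_neq0; apply: val_inj.
by apply: (mulIf nz); rewrite det_powmx // mulrAC divfK // mulrC.
Qed.

End Vandermonde.

Lemma card_ltn_pairs n : #|[set e : 'I_n * 'I_n | (e.1 < e.2)%N]| = 'C(n, 2).
Proof.
rewrite -sum1_card -bin2_sum big_mkord.
rewrite (eq_bigl (fun e : 'I_n * 'I_n => (e.1 < e.2)%N)) => [|e];
  last by rewrite inE.
rewrite -(pair_big_dep xpredT (fun i j : 'I_n => (i < j)%N) (fun _ _ =>
  1%N)) /=.
rewrite (exchange_big_dep xpredT) //=; apply: eq_bigr => j _.
by rewrite (big_ord_narrow (ltnW (ltn_ord j))) sum1_card card_ord.
Qed.

Lemma pdeg_prodB (F : comPzRingType) n (S : {set 'I_n * 'I_n}) :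
  pdeg #|S| (fun x : 'rV[F]_n => \prod_(e in S) (x 0 e.2 - x 0 e.1)).
Proof.
elim/set_ind: S => [|e S eS IH].
  by apply: pdeg_ext (pdeg_const _ _ 1) => x; rewrite big_set0.
rewrite cardsU1 eS; apply: pdeg_ext (pdeg_coordB e.1 e.2 IH) => x.
by rewrite big_setU1.
Qed.

(** * The three blocks of coordinates and counting by block *)

Section Blocks.
Variables p q : nat.
Local Notation n := (p + (1 + q))%N.
Implicit Types (k : 'I_n) (e : 'I_n * 'I_n).

(* Coordinate [k] of [h_p] is [1 - block_index k]. *)
Definition block_index k : nat := (p <= k) + (p < k).

Local Notation block := block_index.

Definition block_perms : {set 'S_n} :=
  [set h : 'S_n | [forall k, block (h k) == block k]].

Definition cross_pairs : {set 'I_n * 'I_n} :=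
  [set e : 'I_n * 'I_n | (block e.1 < block e.2)%N].

Lemma block_A (k : 'I_p) : block (lshift (1 + q) k) = 0%N.
Proof. by have := ltn_ord k; rewrite /block_index /= => kp; lia. Qed.

Lemma block_0 (k : 'I_1) : block (rshift p (lshift q k)) = 1%N.
Proof. by have := ltn_ord k; rewrite /block_index /= => kp; lia. Qed.

Lemma block_B (k : 'I_q) : block (rshift p (rshift 1 k)) = 2%N.
Proof. by rewrite /block_index /=; lia. Qed.

Definition blockE := (block_A, block_0, block_B).

Lemma big_blocks (T : Type) (idx : T) (op : Monoid.com_law idx)
    (G : 'I_n -> 'I_n -> T) :
  let A (k : 'I_p) : 'I_n := lshift (1 + q) k in
  let O : 'I_n := rshift p (lshift q ord0) in
  let B (k : 'I_q) : 'I_n := rshift p (rshift 1 k) in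
  \big[op/idx]_e G e.1 e.2 =
  op (op (\big[op/idx]_i \big[op/idx]_j G (A i) (A j))
         (op (\big[op/idx]_i G (A i) O) (\big[op/idx]_i \big[op/idx]_j G (A i) (B j))))
  (op (op (\big[op/idx]_j G O (A j)) (op (G O O) (\big[op/idx]_j G O (B j))))
      (op (\big[op/idx]_i \big[op/idx]_j G (B i) (A j))
         (op (\big[op/idx]_i G (B i) O) (\big[op/idx]_i \big[op/idx]_j G (B i) (B j))))).
Proof.
move=> A O B; rewrite -(pair_bigA _ G) /=.
have S (g : 'I_n -> T) : \big[op/idx]_k g k =
    op (\big[op/idx]_k g (A k)) (op (g O) (\big[op/idx]_k g (B k))).
  by rewrite big_split_ord /= big_split_ord /= big_ord1.
by rewrite S; congr (op _ (op _ _));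
  rewrite 1?S // (eq_bigr _ (fun i _ => S _)) !big_split.
Qed.

Lemma sum_block (f : nat -> nat) :
  (\sum_(k : 'I_n) f (block k) = p * f 0 + f 1 + q * f 2)%N.
Proof.
rewrite big_split_ord /= big_split_ord /= big_ord1 blockE addnA.
rewrite (eq_bigr (fun=> f 0%N)) => [|i _]; last by rewrite blockE.
rewrite [X in (_ + X)%N](eq_bigr (fun=> f 2%N)) => [|i _];
  last by rewrite blockE.
by rewrite !sum_nat_const !card_ord.
Qed.

Lemma sum_blocks (g : nat -> nat -> nat) :
  (\sum_(e : 'I_n * 'I_n) g (block e.1) (block e.2) =
   p * (p * g 0 0 + g 0 1 + q * g 0 2) + (p * g 1 0 + g 1 1 + q * g 1 2) +
   q * (p * g 2 0 + g 2 1 + q * g 2 2))%N.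
Proof.
rewrite -(pair_bigA _ (fun i j => g (block i) (block j))) /=.
by rewrite (eq_bigr _ (fun i _ => sum_block (g (block i))))
  (sum_block (fun b => p * g b 0 + g b 1 + q * g b 2)%N).
Qed.

Lemma card_cross_pairs : #|cross_pairs| = (p * q + p + q)%N.
Proof.
rewrite -sum1_card big_mkcond /=.
rewrite (eq_bigr (fun e => nat_of_bool (block e.1 < block e.2)%N)); last first.
  by move=> e _; rewrite inE; case: ltnP.
by rewrite (sum_blocks (fun a b => nat_of_bool (a < b)%N)) /=; lia.
Qed.

Lemma block_homo (i j : 'I_n) : (i <= j)%N -> (block i <= block j)%N.
Proof. by rewrite /block_index; lia. Qed.

Lemma block_lt (i j : 'I_n) : (block i < block j)%N -> (i < j)%N.
Proof. by rewrite /block_index; lia. Qed.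

Lemma block_lt3 k : (block k < 3)%N.
Proof. by rewrite /block_index; lia. Qed.

Definition inner_pairs : {set 'I_n * 'I_n} :=
  [set e : 'I_n * 'I_n | (e.1 < e.2)%N && (block e.1 == block e.2)].

Lemma ltn_pairsE :
  [set e : 'I_n * 'I_n | (e.1 < e.2)%N] = inner_pairs :|: cross_pairs.
Proof.
apply/setP => e; rewrite !inE; have := @block_homo e.1 e.2.
by have := @block_lt e.1 e.2; case: ltngtP => //=; case: ltngtP => //= *; lia.
Qed.

Lemma disjoint_inner_cross : [disjoint inner_pairs & cross_pairs].
Proof.
rewrite -setI_eq0; apply/eqP/setP => e; rewrite !inE.
by case: eqP => [->|]; rewrite ?ltnn !(andbF, andFb).
Qed.

Lemma card_inner_pairs :
  (#|inner_pairs| + #|cross_pairs| = 'C(n, 2))%N.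
Proof.
rewrite -card_ltn_pairs ltn_pairsE cardsU.
by move: disjoint_inner_cross; rewrite -setI_eq0 => /eqP->;
  rewrite cards0 subn0.
Qed.

Section Field.
Variable F : numFieldType.
Implicit Types (x : 'rV[F]_n) (d : 'I_n -> nat).

Definition block_vdm x : F := \prod_(e in inner_pairs) (x 0 e.2 - x 0 e.1).

Lemma vdm_block x :
  vdm x = block_vdm x * \prod_(e in cross_pairs) (x 0 e.2 - x 0 e.1).
Proof.
rewrite -[RHS]bigU; last exact: disjoint_inner_cross.
apply: eq_bigl => e; have /setP/(_ e) := ltn_pairsE.
by rewrite in_setU [LHS]inE => ->.
Qed.

Lemma block_vdmE x :
  block_vdm x = vdm (lsubmx x) * vdm (rsubmx (rsubmx x)).
Proof.
rewrite /block_vdm big_mkcond /= (eq_bigr (fun e =>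
  if (e.1 < e.2)%N && (block e.1 == block e.2) then x 0 e.2 - x 0 e.1 else 1));
  last by move=> e _; rewrite inE.
rewrite (big_blocks _ (fun i j =>
  if (i < j)%N && (block i == block j) then x 0 j - x 0 i else 1)) /=.
(* Of the nine products listed by [big_blocks], only those inside the two outer blocks are
   nontrivial. *)
transitivity ((vdm (lsubmx x) * (1 * 1)) *
  ((1 * (1 * 1)) * (1 * (1 * vdm (rsubmx (rsubmx x))))));
  last by rewrite !(mulr1, mul1r).
congr ((_ * (_ * _)) * ((_ * (_ * _)) * (_ * (_ * _))));
  rewrite ?blockE ?andbF //;
  try by do ?[rewrite big1 // => ? _]; rewrite !blockE andbF.
- rewrite -vdm_prod; apply: eq_bigr => i _; rewrite [RHS]big_mkcond.
  by apply: eq_bigr => j _; rewrite !blockE /= andbT !mxE.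
- by rewrite ltnn.
- rewrite -vdm_prod; apply: eq_bigr => i _; rewrite [RHS]big_mkcond.
  by apply: eq_bigr => j _; rewrite !blockE /= andbT !mxE !ltn_add2l.
Qed.

End Field.
End Blocks.

Lemma bin2_double m : ('C(m, 2) * 2 + m = m * m)%N.
Proof. by elim: m => // m; rewrite binS bin1; lia. Qed.

(** * Proportionality of [G V] to the product of the inner differences *)

Section Proportionality.
Variables (F : numFieldType) (p q : nat).
Local Notation n := (p + (1 + q))%N.
Local Notation block := (@block_index p q).
Local Notation H := (block_perms p q).
Local Notation E := (cross_pairs p q).
Implicit Types (x : 'rV[F]_n) (d : 'I_n -> nat).

Definition pair_sum (e : 'I_n * 'I_n) : 'rV[F]_n :=
  delta_mx 0 e.1 + delta_mx 0 e.2.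

Lemma block_permsP (h : 'S_n) :
  reflect (forall k, block (h k) = block k) (h \in H).
Proof. by rewrite inE; apply: (iffP forallP) => hb k; apply/eqP. Qed.

Definition pair_perm (h : 'S_n) (e : 'I_n * 'I_n) := (h e.1, h e.2).

Lemma pair_perm_inj h : injective (pair_perm h).
Proof. by move=> [i j] [i' j'] [/perm_inj -> /perm_inj ->]. Qed.

Lemma pair_perm_stable h (a : nat -> nat -> bool) : h \in H ->
  pair_perm h @: [set e | a (block e.1) (block e.2)] =
  [set e | a (block e.1) (block e.2)].
Proof.
move=> /block_permsP hH; apply/eqP;
  rewrite eqEcard (card_imset _ (@pair_perm_inj h)) leqnn andbT.
by apply/subsetP => y /imsetP[e]; rewrite inE => ae ->; rewrite inE /= !hH.
Qed.

Lemma col_perm_pair_sum h e :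
  col_perm h (pair_sum (pair_perm h e)) = pair_sum e.
Proof. by apply/rowP => k; rewrite !mxE !(inj_eq perm_inj). Qed.

(** A block-preserving [h] permutes the translations belonging to [E] among themselves, so only the
    sign from [vdm] remains. *)
Lemma col_perm_diff_op h x : h \in H ->
  diff_op E pair_sum (@vdm F n) (col_perm h x) =
  (-1) ^+ h * diff_op E pair_sum (@vdm F n) x.
Proof.
move=> hH; have EH : pair_perm h @: E = E.
  exact: (pair_perm_stable (fun a b => (a < b)%N) hH).
rewrite -[in RHS]EH diff_op_imset; last exact: pair_perm_inj.
rewrite mulr_sumr; apply: eq_bigr => A _; rewrite mulrCA -vdm_perm.
congr (_ * vdm _); rewrite [RHS]raddfD raddf_sum; congr (_ + _).
by apply: eq_bigr => e _; rewrite /= col_perm_pair_sum.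
Qed.

(* The group [H] is picked out by the vanishing of the off-diagonal blocks. *)
Definition block_powmx x d : 'M[F]_n :=
  \matrix_(i, j) (if block i == block j then x 0 i ^+ d j else 0).

Lemma sum_block_perms x d :
  \sum_(h in H) (-1) ^+ h * \prod_j col_perm h x 0 j ^+ d j =
  \det (block_powmx x d).
Proof.
rewrite -det_tr big_mkcond /=; apply: eq_bigr => h _.
case: ifPn => [/block_permsP hH|].
  by congr (_ * _); apply: eq_bigr => j _; rewrite !mxE hH eqxx.
rewrite inE => /forallPn[k hk].
by rewrite (bigD1 k) //= !mxE (negPf hk) mul0r mulr0.
Qed.

Lemma det_block_powmx x d :
  \det (block_powmx x d) =
  \det (powmx (lsubmx x) (fun k => d (lshift (1 + q) k))) *
  (x 0 (rshift p (lshift q ord0)) ^+ d (rshift p (lshift q ord0)) *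
   \det (powmx (rsubmx (rsubmx x)) (fun k => d (rshift p (rshift 1 k))))).
Proof.
rewrite -[block_powmx x d]submxK (_ : ursubmx _ = 0); last first.
  apply/matrixP => i j; rewrite !mxE blockE.
  by case: (split_ordP j) => k ->; rewrite ?(ord1 k) blockE.
rewrite det_lblock; congr (_ * _).
  by congr (\det _); apply/matrixP => i j; rewrite !mxE !blockE.
rewrite -[drsubmx _]submxK (_ : ursubmx _ = 0); last first.
  by apply/matrixP => i j; rewrite !mxE (ord1 i) !blockE.
rewrite det_lblock; congr (_ * _).
  by rewrite det_mx11 !mxE !blockE.
by congr (\det _); apply/matrixP => i j; rewrite !mxE !blockE.
Qed.

Definition alternate (f : 'rV[F]_n -> F) x : F :=
  \sum_(h in H) (-1) ^+ h * f (col_perm h x).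

(** The determinant splits over the blocks. If neither outer determinant vanishes identically, they
    need degrees ['C(p, 2)] and ['C(q, 2)] at least; this uses up the whole degree, so the middle
    exponent is 0. *)
Lemma alternate_monomial d :
  (\sum_j d j <= 'C(p, 2) + 'C(q, 2))%N ->
  exists k, forall x, alternate (fun y => \prod_j y 0 j ^+ d j) x =
    k * block_vdm x.
Proof.
rewrite big_split_ord /= big_split_ord /= big_ord1.
set dA := fun k => d (lshift _ k); set d0 := d (rshift p (lshift q ord0)).
set dB := fun k => d (rshift p (rshift 1 k)) => led.
have [A0|[leA hA]] := det_powmx_low_degree F dA.
  by exists 0 => x; rewrite /alternate sum_block_perms det_block_powmx A0 !mul0r.
have [B0|[leB hB]] := det_powmx_low_degree F dB.
  by exists 0 => x; rewrite /alternate sum_block_perms det_block_powmx B0 !(mulr0, mul0r).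
have [|kA KA] := hA; first by move: led leA leB; rewrite /dA /dB /=; lia.
have [|kB KB] := hB; first by move: led leA leB; rewrite /dA /dB /=; lia.
have d00 : d0 = 0%N by move: led leA leB; rewrite /dA /dB /=; lia.
exists (kA * kB) => x; rewrite /alternate sum_block_perms det_block_powmx.
by rewrite -/d0 d00 expr0 mul1r KA KB block_vdmE; ring.
Qed.

(** The monomial in front is an accumulator: in the induction on [pdeg], each coordinate factor of
    [f] moves into [d] until only a monomial is left. *)
Lemma alternate_low_degree m (f : 'rV[F]_n -> F) d :
  pdeg m f -> (\sum_j d j + m <= 'C(p, 2) + 'C(q, 2))%N ->
  exists k, forall x, alternate (fun y => \prod_j y 0 j ^+ d j * f y) x =
    k * block_vdm x.
Proof.
move=> Hf; elim: Hf d => {m f} [m c|m i f _ IH|m f g _ IHf _ IHg|m f g fg _ IH] d le.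
- have [|k Hk] := @alternate_monomial d;
  first exact: leq_trans (leq_addr _ _) le.
  exists (k * c) => x; rewrite mulrAC -Hk mulr_suml.
  by apply: eq_bigr => h _; rewrite mulrA.
- have [|k Hk] := IH (fun j => (d j + (j == i))%N).
    rewrite big_split /= [X in (_ + X + _)%N](bigD1 i) //= eqxx.
    rewrite [X in (_ + (_ + X) + _)%N]big1 ?addn0 => [|j /negPf->] //.
    by rewrite -addnA.
  exists k => x; rewrite -Hk; apply: eq_bigr => h _; congr (_ * _).
  rewrite mulrA; congr (_ * _).
  rewrite (eq_bigr _ (fun j _ => exprD _ _ _)) big_split /=; congr (_ * _).
  by rewrite [RHS](bigD1 i) //= eqxx expr1 big1 ?mulr1 // => j /negPf->.
- have [k Hk] := IHf d le; have [l Hl] := IHg d le.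
  exists (k + l) => x; rewrite mulrDl -Hk -Hl -big_split /=.
  by apply: eq_bigr => h _; rewrite -mulrDr -mulrDr.
- have [k Hk] := IH d le; exists k => x; rewrite -Hk.
  by apply: eq_bigr => h _; rewrite fg.
Qed.

Lemma pdeg_vdm : pdeg 'C(n, 2) (@vdm F n).
Proof.
rewrite -card_ltn_pairs; apply: pdeg_ext (pdeg_prodB _ _) => x.
by apply: eq_bigl => e; rewrite inE.
Qed.

Lemma diff_op_vdm :
  exists k, forall x, diff_op E pair_sum (@vdm F n) x = k * block_vdm x.
Proof.
have degE : (#|E| + ('C(p, 2) + 'C(q, 2)) = 'C(n, 2))%N.
  rewrite card_cross_pairs; have := bin2_double (p + (1 + q)).
  by have := bin2_double p; have := bin2_double q; lia.
have := pdeg_vdm; rewrite -degE => /pdeg_diff_op Hd.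
have [|k Hk] := @alternate_low_degree _ _ (fun=> 0%N) (Hd pair_sum).
  by rewrite big1.
(* [G V] is already antisymmetric under [H], so [alternate] multiplies it by [#|H|], which is
   invertible in characteristic 0. *)
exists (#|H|%:R^-1 * k) => x; rewrite -mulrA -Hk.
have nzH : #|H|%:R != 0 :> F.
  rewrite pnatr_eq0 -lt0n card_gt0; apply/set0Pn; exists 1%g.
  by apply/block_permsP => j; rewrite perm1.
apply: (mulfI nzH); rewrite mulVKf // mulr_natl -sumr_const.
apply: eq_bigr => h hH; rewrite big1 ?mul1r => [|j _]; last exact: expr0.
by rewrite col_perm_diff_op // mulrA -expr2 sqrr_sign mul1r.
Qed.

End Proportionality.

(** * Evaluation at the point of ranks within the blocks *)

Section Evaluation.
Variables (F : numFieldType) (p q : nat).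
Local Notation n := (p + (1 + q))%N.
Local Notation block := (@block_index p q).
Local Notation H := (block_perms p q).
Local Notation E := (cross_pairs p q).
Implicit Types (w : 'rV[F]_n) (M : {set 'I_n * 'I_n}) (s h : 'S_n).

(** The values are [0, ..., p - 1], then [0], then [0, ..., q - 1]: the point at which [G V] is
    evaluated. *)
Definition block_rank (j : 'I_n) : nat := (j - (0 < block j) * p - (1 < block j))%N.

(** The degree of the vertex [j] in the graph with edge set [M]. It occurs both as a coordinate of a
    translation and as an exponent. *)
Definition degree_in M (j : 'I_n) : nat := \sum_(e in M) ((e.1 == j) + (e.2 == j)).

Definition pair_factor w : F := \prod_(e in E) (1 - w 0 e.1 * w 0 e.2).

Lemma prod_pairs w M :
  \prod_(e in M) (w 0 e.1 * w 0 e.2) = \prod_j w 0 j ^+ degree_in M j.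
Proof.
rewrite [RHS](eq_bigr _ (fun j _ => expr_sum _ _ _ _)) exchange_big /=.
apply: eq_bigr => e _; rewrite (eq_bigr _ (fun j _ =>
  exprD _ _ _)) big_split /=.
have X k : \prod_j w 0 j ^+ (k == j) = w 0 k.
  by rewrite (bigD1 k) //= eqxx expr1 big1 ?mulr1 // => j;
    rewrite eq_sym => /negPf->.
by rewrite !X.
Qed.

Lemma nat_row_pair_sum d M :
  nat_row F d + \sum_(e in M) pair_sum F e =
  nat_row F (fun j => d j + degree_in M j)%N.
Proof.
apply/rowP => j; rewrite !mxE summxE natrD natr_sum; congr (_ + _).
by apply: eq_bigr => e _; rewrite !mxE natrD !eqxx /= eq_sym [_ == e.2]eq_sym.
Qed.

(** In the complete multipartite graph [E] the degree of [j] is [n] minus the size of its block, and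
    the rank of [j] is below that size. *)
Lemma degree_in_lt M j : M \subset E -> (block_rank j + degree_in M j < n)%N.
Proof.
move=> sM; have : (degree_in M j <= degree_in E j)%N.
  by rewrite /degree_in [leqRHS](big_setID M) /= (setIidPr sM) leq_addr.
suff -> : degree_in E j = (\sum_(k : 'I_n) ((block j < block k) + (block k < block j)))%N.
  rewrite (@sum_block p q (fun b => (block j < b) + (b < block j))%N).
  by rewrite /block_rank /block_index; have := ltn_ord j; lia.
rewrite /degree_in big_mkcond (eq_bigr (fun e : 'I_n * 'I_n =>
    (block e.1 < block e.2) * (e.1 == j) + (block e.1 < block e.2) * (e.2 == j))%N);
  last by move=> e _; rewrite inE -mulnDr; case: (_ < _)%N; rewrite ?mul1n.
rewrite !big_split /=; congr (_ + _)%N.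
  rewrite -(pair_bigA _ (fun a b => (block a < block b) * (a == j))%N) /=.
  rewrite (bigD1 j) //= [X in (_ + X)%N]big1 ?addn0 => [|a /negPf aj].
    by apply: eq_bigr => k _; rewrite eqxx muln1.
  by apply: big1 => k _; rewrite aj muln0.
rewrite -(pair_bigA _ (fun a b => (block a < block b) * (b == j))%N) /=.
apply: eq_bigr => k _.
by rewrite (bigD1 j) //= eqxx muln1 big1 ?addn0 // => a /negPf->; rewrite muln0.
Qed.

(** Both sides expand over [M \subset E]. For each [M] the sum over [s] is a determinant with
    exponents [block_rank j + degree_in M j], and [det_powmx] reads these exponents as the translate
    of the rank point belonging to [M]. *)
Lemma alternating_pair_factor (z : 'rV[F]_n) :
  (\sum_(s : 'S_n) (-1) ^+ s *
    (\prod_j col_perm s z 0 j ^+ block_rank j * pair_factor (col_perm s z))) *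
    vdm (nat_row F (@nat_of_ord n)) =
  vdm z * diff_op E (@pair_sum F p q) (@vdm F n) (nat_row F block_rank).
Proof.
rewrite mulr_sumr mulr_suml.
under eq_bigr do rewrite /pair_factor prod_one_sub mulr_sumr mulr_sumr mulr_suml.
rewrite exchange_big /=; apply: eq_bigr => M sM.
rewrite nat_row_pair_sum [RHS]mulrCA -det_powmx; last by move=> j;
  apply: degree_in_lt.
rewrite mulrA -mulr_suml; congr (_ * _).
rewrite -det_tr mulr_sumr; apply: eq_bigr => s _.
rewrite [RHS]mulrCA; congr (_ * _); rewrite [LHS]mulrCA prod_pairs;
  congr (_ * _).
by rewrite -big_split; apply: eq_bigr => j _; rewrite !mxE exprD.
Qed.

Lemma pair_factor_col_perm h w : h \in H ->
  pair_factor (col_perm h w) = pair_factor w.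
Proof.
move=> hH; have EH : pair_perm h @: E = E.
  exact: (pair_perm_stable (fun a b => (a < b)%N) hH).
rewrite /pair_factor -[in RHS]EH big_imset;
  last by move=> e e' _ _ /pair_perm_inj.
by apply: eq_bigr => e _; rewrite !mxE.
Qed.

Lemma alternate_block_rank w :
  \sum_(h in H) (-1) ^+ h *
    (\prod_j col_perm h w 0 j ^+ block_rank j * pair_factor (col_perm h w)) =
  block_vdm w * pair_factor w.
Proof.
rewrite (eq_bigr (fun h => (-1) ^+ h *
    (\prod_j col_perm h w 0 j ^+ block_rank j) * pair_factor w)); last first.
  by move=> h hH; rewrite pair_factor_col_perm // mulrA.
rewrite -mulr_suml sum_block_perms det_block_powmx block_vdmE !vdmE.
congr (_ * _); have -> : block_rank (rshift p (lshift q ord0)) = 0%N.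
  by rewrite /block_rank blockE /=; lia.
rewrite expr0 mul1r; congr (_ * _); congr (\det _); apply/matrixP => i j;
  rewrite !mxE.
  by rewrite /block_rank blockE /= mul0n !subn0.
by rewrite /block_rank blockE; congr (_ ^+ _); rewrite /=; lia.
Qed.

Hypotheses (p_even : ~~ odd p) (q_even : ~~ odd q).

(** Applying [io] to the first index permutes [E] and turns [1 - w_i w_j] into
    [1 - w_j / w_i = - (w_j - w_i) / w_i]. By the same substitution the product of the [w_i] is its
    own inverse, hence 1 by positivity; the number [p q + p + q] of signs is even. *)
Lemma prod_cross_invol (io : 'S_n) w :
  io \in H -> (forall k, io (io k) = k) -> (forall k, 0 < w 0 k) ->
  (forall k, w 0 (io k) * w 0 k = 1) ->
  pair_factor w = \prod_(e in E) (w 0 e.2 - w 0 e.1).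
Proof.
move=> /block_permsP ioH ioK wpos wio.
have wV k : w 0 (io k) = (w 0 k)^-1.
  by apply: (mulIf (lt0r_neq0 (wpos k))); rewrite wio mulVf // lt0r_neq0.
pose g (e : 'I_n * 'I_n) := (io e.1, e.2).
have reE (f : 'I_n * 'I_n -> F) : \prod_(e in E) f e = \prod_(e in E) f (g e).
  rewrite (reindex_onto g g) /=; last by case=> i j _; rewrite /g ioK.
  apply: eq_bigl => -[i j]; rewrite !inE /= ioH /g /= ioK eqxx andbT //.
set P := \prod_(e in E) w 0 e.1.
have Ppos : 0 < P by apply: prodr_gt0 => e _.
have P1 : P = 1.
  have : P = P^-1.
    rewrite -prodfV {1}/P reE; apply: eq_bigr => e _; exact: wV.
  move=> PV; apply/eqP; rewrite -(@pexpr_eq1 _ _ 2) ?ltW // expr2 {1}PV.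
  by rewrite mulVf // lt0r_neq0.
rewrite /pair_factor [LHS]reE (eq_bigr (fun e =>
  - (w 0 e.1)^-1 * (w 0 e.2 - w 0 e.1))).
  rewrite big_split /= prodrN prodfV -/P P1 invr1 mulr1 card_cross_pairs.
  by rewrite -signr_odd !oddD oddM (negPf p_even) (negPf q_even) /= mul1r.
move=> e _; rewrite /g /= wV mulNr mulrBr mulVf ?lt0r_neq0 //.
by rewrite opprB.
Qed.

End Evaluation.

(** * Permutations that contribute at a point symmetric under inversion *)

Section Survivors.
Variables (F : numFieldType) (p q : nat).
Hypotheses (p_even : ~~ odd p) (q_even : ~~ odd q).
Local Notation n := (p + (1 + q))%N.
Local Notation block := (@block_index p q).
Local Notation H := (block_perms p q).
Local Notation E := (cross_pairs p q).
Implicit Types (s h : 'S_n) (k v : 'I_n).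

Definition rev_perm : 'S_n := perm (@rev_ord_inj n).

(** Products act from left to right: a position goes to its value index, then to that of the inverse
    value, then back to a position. *)
Definition position_rev s : 'S_n := (s * rev_perm * s^-1)%g.

Definition rev_stable : {set 'S_n} := [set s | position_rev s \in H].

(** A value index gets the block of the position where [s] puts it. [inord] never takes its default,
    since block indices are below 3. *)
Definition colouring s : {ffun 'I_n -> 'I_3} := [ffun v =>
  inord (block (s^-1 v)%g)].

(** For even [p] and [q] the exponents of 2 run from [-(n - 1) / 2] to [(n - 1) / 2]: the
    coordinates are positive, distinct, and inverted by [rev_ord]. *)
Definition sym_point : 'rV[F]_n := \row_k (2 ^+ k / 2 ^+ (p./2 + q./2)).

Lemma colouring_eq s k : colouring s (s k) = block k :> nat.
Proof. by rewrite ffunE permK inordK // block_lt3. Qed.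

Lemma position_revE s k : s (position_rev s k) = rev_ord (s k).
Proof. by rewrite !permM permKV permE. Qed.

Lemma position_revK s k : position_rev s (position_rev s k) = k.
Proof. by apply: (@perm_inj _ s); rewrite !position_revE rev_ordK. Qed.

Lemma sym_point_gt0 k : 0 < sym_point 0 k.
Proof. by rewrite mxE divr_gt0 // exprn_gt0 // ltr0n. Qed.

Lemma sym_point_rev k : sym_point 0 (rev_ord k) * sym_point 0 k = 1.
Proof.
rewrite !mxE mulrACA -exprD -invfM -exprD /=.
have -> : (p + (1 + q) - k.+1 + k = p./2 + q./2 + (p./2 + q./2))%N.
  by have := ltn_ord k; lia.
by rewrite divff // expf_neq0 // pnatr_eq0.
Qed.

Lemma vdm_sym_point : vdm sym_point != 0.
Proof.
apply: vdm_neq0 => i j; rewrite !mxE => /(mulIf _) eij; apply: val_inj.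
have := eij _; rewrite invr_eq0 expf_neq0 ?pnatr_eq0 // => /(_ isT).
by apply: ieexprIn; rewrite ?ltr0n // pnatr_eq1.
Qed.

Lemma block_permsM : {in H &, forall h h', (h * h')%g \in H}.
Proof.
move=> h h' /block_permsP hH /block_permsP hH'; apply/block_permsP => k.
by rewrite permM hH' hH.
Qed.

Lemma block_permsV : {in H, forall h, (h^-1)%g \in H}.
Proof.
by move=> h /block_permsP hH; apply/block_permsP => k; rewrite -hH permKV.
Qed.

Lemma rev_stableE s : (s \in rev_stable) = (position_rev s \in H).
Proof. by rewrite in_set. Qed.

Lemma rev_stableM h s : h \in H -> ((h * s)%g \in rev_stable) = (s \in rev_stable).
Proof.
have sub h' s' : h' \in H -> s' \in rev_stable -> (h' * s')%g \in rev_stable.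
  move=> hH; rewrite !rev_stableE => sS.
  have : (h' * position_rev s' * h'^-1)%g \in H.
    by apply: block_permsM (block_permsV hH); apply: block_permsM.
  by rewrite /position_rev invMg !mulgA.
move=> hH; apply/idP/idP; last exact: sub.
by move/(sub _ _ (block_permsV hH)); rewrite mulKg.
Qed.

Lemma colouringM h s : (colouring (h * s)%g == colouring s) = (h \in H).
Proof.
apply/eqP/block_permsP => [eq k|hH].
  by rewrite -(colouring_eq s) -eq -permM colouring_eq.
apply/ffunP => v; apply: ord_inj; rewrite -[v](permKV (h * s)%g).
by rewrite colouring_eq permM colouring_eq hH.
Qed.

Lemma col_perm_row (x : 'rV[F]_n) s k : col_perm s x 0 k = x 0 (s k).
Proof. by rewrite mxE. Qed.

(** Some value and its inverse lie in different blocks, and their pair gives a factor [1 - 1]. *)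
Lemma pair_factor_unstable s :
  s \notin rev_stable -> pair_factor (col_perm s sym_point) = 0.
Proof.
rewrite !inE => /forallPn[k hk].
have z1 : sym_point 0 (s k) * sym_point 0 (s (position_rev s k)) = 1.
  by rewrite position_revE mulrC sym_point_rev.
apply/eqP; rewrite prodf_seq_eq0; apply/hasP.
have [lt|] := boolP (block k < block (position_rev s k))%N.
  exists (k, position_rev s k); rewrite ?mem_index_enum // inE lt /=.
  by rewrite !col_perm_row z1 subrr.
rewrite -leqNgt leq_eqVlt (negPf hk) /= => lt.
exists (position_rev s k, k); rewrite ?mem_index_enum // inE lt /=.
by rewrite !col_perm_row mulrC z1 subrr.
Qed.

(** The class is the coset [H s], and summing over it leaves [block_vdm w * pair_factor w]. With the
    involution [position_rev s] the second factor becomes the cross differences missing from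
    [vdm w]; the two signs of [s] cancel. *)
Lemma sum_rev_stable_class s : s \in rev_stable ->
  \sum_(t in rev_stable | colouring t == colouring s) (-1) ^+ t *
    (\prod_j col_perm t sym_point 0 j ^+ block_rank j *
     pair_factor (col_perm t sym_point)) = vdm sym_point.
Proof.
move=> sS; rewrite (reindex_inj (mulIg s)) /=.
set w := col_perm s sym_point.
rewrite (eq_big (fun h => h \in H) (fun h => (-1) ^+ s * ((-1) ^+ h *
  (\prod_j col_perm h w 0 j ^+ block_rank j * pair_factor (col_perm h w))))).
- rewrite -mulr_sumr alternate_block_rank.
  rewrite (@prod_cross_invol _ _ _ p_even q_even (position_rev s)).
  + by rewrite -vdm_block vdm_perm mulrA -expr2 sqrr_sign mul1r.
  + by rewrite -rev_stableE.
  + exact: position_revK.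
  + by move=> k; rewrite col_perm_row sym_point_gt0.
  + by move=> k; rewrite !col_perm_row position_revE sym_point_rev.
- move=> h; rewrite colouringM; case: (boolP (h \in H)) => hH;
  last by rewrite andbF.
  by rewrite rev_stableM // sS.
- move=> h _; have -> : col_perm (h * s)%g sym_point = col_perm h w.
    by apply/rowP => j; rewrite !col_perm_row permM.
  by rewrite odd_permM signr_addb [X in X * _]mulrC -mulrA.
Qed.

Lemma sum_all_perms :
  \sum_(t : 'S_n) (-1) ^+ t *
    (\prod_j col_perm t sym_point 0 j ^+ block_rank j *
     pair_factor (col_perm t sym_point)) =
  vdm sym_point * #|colouring @: rev_stable|%:R.
Proof.
rewrite (bigID (mem rev_stable)) /= [X in _ + X]big1 ?addr0; last first.
  by move=> t tS; rewrite pair_factor_unstable // !mulr0.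
rewrite (partition_big_imset colouring) /= mulr_natr -sumr_const.
apply: eq_bigr => c /imsetP[s sS ->].
by rewrite -[RHS](sum_rev_stable_class sS); apply: eq_bigl => t; rewrite inE.
Qed.

(** * Counting the colourings by subsets of the lower half *)

Lemma mid_lt : (p./2 + q./2 < n)%N.
Proof. by lia. Qed.

Definition mid : 'I_n := Ordinal mid_lt.

Definition lower_half : {set 'I_n} := [set v : 'I_n | (v < mid)%N].

Lemma rev_eq_mid v : (rev_ord v == v) = (v == mid).
Proof.
rewrite -!val_eqE /=; have := ltn_ord v; move: (nat_of_ord v) => a.
by lia.
Qed.

Lemma rev_lower_half v : v != mid -> (rev_ord v \in lower_half) = (v \notin lower_half).
Proof. by rewrite !inE -val_eqE /=; have := ltn_ord v; lia. Qed.

Lemma colouring_rev s v : s \in rev_stable ->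
  colouring s (rev_ord v) = colouring s v.
Proof.
rewrite rev_stableE => /block_permsP sS; apply: ord_inj.
by rewrite -[v](permKV s) -position_revE !colouring_eq sS.
Qed.

(** Block 1 has a single position, so [position_rev s] fixes it; its value index is then fixed by
    [rev_ord], and only [mid] is. *)
Lemma colouring_eq1 s v : s \in rev_stable ->
  (colouring s v == 1%N :> nat) = (v == mid).
Proof.
rewrite rev_stableE => /block_permsP sS.
have b1 k : (block k == 1%N) = (k == p :> nat).
  by rewrite /block_index; lia.
have k0_lt : (p < n)%N by lia.
pose k0 := Ordinal k0_lt.
have -> : mid = s k0.
  apply/esym/eqP; rewrite -rev_eq_mid -position_revE (inj_eq perm_inj).
  by rewrite -val_eqE -b1 sS b1.
rewrite -{1}[v](permKV s) colouring_eq b1 -[in RHS](permKV s v) (inj_eq perm_inj).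
by rewrite -val_eqE.
Qed.

(** The lower half represents the pairs [{v, rev_ord v}]; this set records which of them go to the
    first block. *)
Definition lower_zeros (c : {ffun 'I_n -> 'I_3}) : {set 'I_n} :=
  [set v in lower_half | c v == 0%N :> nat].

Lemma lower_zerosE c v :
  (v \in lower_zeros c) = (v \in lower_half) && (c v == 0%N :> nat).
Proof. by rewrite in_set. Qed.

(** Colour 1 occurs at [mid] only, so the zeros determine the colouring on the lower half, and
    symmetry under [rev_ord] determines the rest. *)
Lemma lower_zeros_inj : {in colouring @: rev_stable &, injective lower_zeros}.
Proof.
move=> c d /imsetP[s sS ->] /imsetP[t tS ->] {c d} eqz.
have low v : v \in lower_half -> colouring s v = colouring t v.
  move=> vL; have vm : v != mid by apply: contraTneq vL => ->; rewrite inE ltnn.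
  have := congr1 (fun A : {set 'I_n} => v \in A) eqz.
  rewrite /= !lower_zerosE vL /=.
  have := colouring_eq1 v sS; have := colouring_eq1 v tS; rewrite (negPf vm).
  move=> c1 d1 z; apply: ord_inj; move: c1 d1 z.
  by have := ltn_ord (colouring s v); have := ltn_ord (colouring t v); lia.
apply/ffunP => v; have [vL|vL] := boolP (v \in lower_half); first exact: low.
have [->|vm] := eqVneq v mid.
  apply: ord_inj; have := colouring_eq1 mid sS; have := colouring_eq1 mid tS.
  by rewrite eqxx => /eqP-> /eqP->.
by rewrite -(colouring_rev _ sS) -(colouring_rev _ tS) low // rev_lower_half.
Qed.

Lemma card_rev_closure (T : {set 'I_n}) : T \subset lower_half ->
  #|T :|: [set v | rev_ord v \in T]| = (2 * #|T|)%N.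
Proof.
move=> TL; rewrite cardsU (_ : T :&: _ = set0) ?cards0 ?subn0.
  rewrite mul2n -addnn; congr (_ + _)%N.
  rewrite -[RHS](card_imset _ (@rev_ord_inj n)); apply: eq_card => v.
  by rewrite inE -[v in RHS]rev_ordK mem_imset //; apply: rev_ord_inj.
apply/setP => v; rewrite !inE; apply/andP => -[vT rvT].
have := subsetP TL _ vT; have := subsetP TL _ rvT; rewrite !inE /=.
by have := ltn_ord v; lia.
Qed.

(** Together with its mirror image this set is the whole colour class 0, which has [p] elements. *)
Lemma card_lower_zeros s : s \in rev_stable -> #|lower_zeros (colouring s)| = p./2.
Proof.
move=> sS; have sub : lower_zeros (colouring s) \subset lower_half.
  by apply/subsetP => v; rewrite inE => /andP[].
have := card_rev_closure sub.
rewrite (_ : _ :|: _ = s @: [set k : 'I_n | block k == 0%N]).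
  rewrite card_imset; last exact: perm_inj.
  rewrite -sum1_card big_mkcond (eq_bigr (fun k =>
    nat_of_bool (block k == 0%N))) /=.
    by rewrite (@sum_block p q (fun b => nat_of_bool (b == 0%N))) /=; lia.
  by move=> k _; rewrite inE; case: eqP.
apply/setP => v; rewrite in_setU lower_zerosE [X in _ || X]in_set lower_zerosE colouring_rev //.
rewrite -[v in RHS](permKV s) mem_imset; last exact: perm_inj.
rewrite [RHS]in_set -(colouring_eq s) permKV.
have [->|vm] := eqVneq v mid.
  by have := colouring_eq1 mid sS; rewrite eqxx => /eqP->; rewrite !andbF.
by rewrite -andb_orl rev_lower_half // orbN.
Qed.

Lemma sum_colour (T : {set 'I_n}) (g : nat -> nat) :
  T \subset lower_half -> #|T| = p./2 ->
  (\sum_v g (if v \in T :|: [set v | rev_ord v \in T] then 0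
             else if v == mid then 1 else 2) = p * g 0 + g 1 + q * g 2)%N.
Proof.
move=> TL cT; have := card_rev_closure TL; rewrite cT.
set S := T :|: _ => cS.
have mS : mid \notin S.
  rewrite !inE; have /eqP-> : rev_ord mid == mid by rewrite rev_eq_mid.
  by rewrite orbb; apply: contraTN isT => /(subsetP TL); rewrite inE ltnn.
have gen (f : nat -> nat) : (\sum_v f (if v \in S then 0 else if v == mid then 1 else 2) =
    #|S| * f 0 + f 1 + #|[pred v | v \notin S & v != mid]| * f 2)%N.
  rewrite (bigID (mem S)) /= (eq_bigr (fun=> f 0%N)) => [|v /= ->] //.
  rewrite [X in (_ + X)%N](bigD1 mid) //= (negPf mS) eqxx addnA.
  rewrite [X in (_ + X)%N](eq_bigr (fun=> f 2%N)) =>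
    [|v /andP[/negPf-> /negPf->]] //.
  by rewrite !sum_nat_const.
have := gen (fun=> 1%N); rewrite sum1_card card_ord gen !muln1 => cn.
have -> : #|[pred v | v \notin S & v != mid]| = q by lia.
by have -> : #|S| = p by lia.
Qed.

(** The colouring prescribed by [T] uses each colour as often as the blocks do, so a permutation
    carries one to the other; it is stable because the prescription is symmetric under [rev_ord]. *)
Lemma exists_rev_stable (T : {set 'I_n}) : T \subset lower_half -> #|T| = p./2 ->
  exists2 s, s \in rev_stable & lower_zeros (colouring s) = T.
Proof.
move=> TL cT; pose c (v : 'I_n) : nat := if v \in T :|: [set v | rev_ord v \in T] then 0
             else if v == mid then 1 else 2.
have : perm_eq [tuple block k | k < n] [tuple c v | v < n].
  apply/seq.permP => a; rewrite -!sum1_count !big_map /=.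
  rewrite big_mkcond [RHS]big_mkcond /=.
  rewrite (@sum_block p q (fun b => if a b then 1%N else 0%N)).
  by rewrite (@sum_colour T (fun b => if a b then 1%N else 0%N)).
move/tuple_permP => [s /(congr1 (fun t => nth 0%N t _))/= cs].
have bc k : block k = c (s k).
  have := cs k; rewrite -!(tnth_nth _ [tuple _ | _ < _]) !tnth_mktuple //.
exists s.
  rewrite rev_stableE; apply/block_permsP => k; rewrite !bc position_revE.
  rewrite /c !inE rev_ordK orbC -!rev_eq_mid rev_ordK.
  by rewrite eq_sym.
apply/setP => v; rewrite inE -[v in colouring s v](permKV s) colouring_eq bc permKV /c !inE.
have [vT|vT] /= := boolP (v \in T).
  by have := subsetP TL _ vT; rewrite inE => ->.
have [vL|//] /= := boolP (v < mid)%N.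
have -> : rev_ord v \in T = false.
  apply: contraTF vL => /(subsetP TL); rewrite inE /=; have := ltn_ord v; lia.
by case: (v == mid).
Qed.

Lemma card_colourings : #|colouring @: rev_stable| = 'C(p./2 + q./2, p./2).
Proof.
rewrite -(card_in_imset lower_zeros_inj).
have -> : (p./2 + q./2)%N = #|lower_half|.
  rewrite -sum1_card (eq_bigl (fun v : 'I_n => (v < mid)%N)) => [|v].
    by rewrite (big_ord_narrow (ltnW mid_lt)) sum1_card card_ord.
  by rewrite inE.
rewrite -cards_draws; apply: eq_card => T; rewrite inE.
apply/imsetP/andP => [[c /imsetP[s sS ->] ->]|[TL /eqP cT]].
  by rewrite card_lower_zeros //; split=> //; apply/subsetP => v;
    rewrite inE => /andP[].
have [s sS <-] := exists_rev_stable TL cT.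
by exists (colouring s) => //; apply: imset_f.
Qed.

Lemma diff_op_block_rank :
  diff_op E (@pair_sum F p q) (@vdm F n) (nat_row F (@block_rank p q)) =
  vdm (nat_row F (@nat_of_ord n)) * ('C(p./2 + q./2, p./2))%:R.
Proof.
apply: (mulfI vdm_sym_point); rewrite -alternating_pair_factor sum_all_perms.
by rewrite card_colourings mulrAC mulrA.
Qed.

End Survivors.

Local Open Scope complex_scope.

(** * Root labels and Weyl dimension polynomials *)

Section Labels.
Variables (R : realType) (n : nat).
Implicit Types (x lam : 'rV[R[i]]_n).

Definition pair_label (m t : bool) (e : 'I_n * 'I_n) : rlabel n := (e.1, e.2, m, t).

Lemma pair_label_inj m t : injective (pair_label m t).
Proof. by move=> [i j] [i' j'] [-> ->]. Qed.

Lemma mem_pair_label m t (S : {set 'I_n * 'I_n}) i j m' t' :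
  ((i, j, m', t') \in pair_label m t @: S) =
  [&& m' == m, t' == t & (i, j) \in S].
Proof.
apply/imsetP/and3P => [[[i' j'] eS [-> -> -> ->]]|[/eqP-> /eqP-> eS]] //.
by exists (i, j).
Qed.

Lemma dotC_rootv x i j m t :
  dotC x (rootv R (i, j, m, t)) = (-1) ^+ t * (x 0 i + (-1) ^+ m * x 0 j).
Proof.
have dotE (k : 'I_n) : \sum_l x 0 l * (eps R k) 0 l = x 0 k.
  rewrite (bigD1 k) //= mxE !eqxx mulr1 big1 ?addr0 // => l /negPf lk.
  by rewrite mxE lk andbF mulr0.
rewrite -!dotE mulr_sumr -big_split mulr_sumr; apply: eq_bigr => l _ /=.
by rewrite !mxE; ring.
Qed.

Lemma dotCC x y : dotC x y = dotC y x.
Proof. by apply: eq_bigr => k _; rewrite mulrC. Qed.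

Lemma rho_double (A : {set rlabel n}) : 2 *: rho R A = \sum_(a in A) rootv R a.
Proof. by rewrite scalerA divff ?scale1r // pnatr_eq0. Qed.

Lemma diff_op_translate (I : finType) (D : {set I}) v (f : 'rV[R[i]]_n -> R[i]) c x :
  diff_op D v (fun y => f (y + c)) x = diff_op D v f (x + c).
Proof. by apply: eq_bigr => A _; rewrite addrAC. Qed.

Lemma alternating_sumE h lam :
  alternating_sum h lam = (-1) ^+ N_h h *
    diff_op (l_pos_noncompact_roots h) (@rootv R n)
      (diff_op (p1_roots h) (fun a => - rootv R a) (@P_K R n))
      (lam - rho R (l_pos_noncompact_roots h)).
Proof.
congr (_ * _); apply: eq_bigr => A _; rewrite mulr_sumr; apply: eq_bigr => C _.
by rewrite exprD -mulrA !rho_double sumrN.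
Qed.

Section Monotone.
Variable b : 'I_n -> nat.
Hypothesis b_homo : forall i j : 'I_n, (i <= j)%N -> (b i <= b j)%N.

(** A constant [b] yields the positive compact roots of the whole algebra, and [block_index] those
    of the centralizer of [h_p]. *)
Definition mono_pairs : {set 'I_n * 'I_n} :=
  [set e : 'I_n * 'I_n | (e.1 < e.2)%N && (b e.1 == b e.2)].

Lemma sum_ltn_ord (c : nat) : (c <= n)%N -> (\sum_(j < n) (j < c) = c)%N.
Proof.
move=> cn; rewrite -[RHS]card_ord -sum1_card (big_ord_widen _ (fun=> 1%N) cn).
by rewrite [RHS]big_mkcond; apply: eq_bigr => j _; case: ltnP.
Qed.

Lemma rho_mono_pairs k :
  2 * rho R (pair_label true false @: mono_pairs) 0 k =
  \sum_(j < n) (((k < j) && (b k == b j))%N%:R - ((j < k) && (b j == b k))%N%:R).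
Proof.
pose P (i j : 'I_n) : R[i] := ((i < j) && (b i == b j))%N%:R.
transitivity (\sum_(e : 'I_n * 'I_n) (P e.1 e.2 * (e.1 == k)%:R - P e.1 e.2 * (e.2 == k)%:R)).
  transitivity ((2 *: rho R (pair_label true false @: mono_pairs)) 0 k);
    first by rewrite !mxE.
  rewrite rho_double summxE big_imset /=;
    last by move=> e e' _ _ /pair_label_inj.
  rewrite big_mkcond; apply: eq_bigr => e _; rewrite inE /P; case: andP => _;
    last first.
    by rewrite !mul0r subrr.
  by rewrite !mxE eqxx /= !(eq_sym k) expr0 expr1 !mul1r mulN1r.
rewrite big_split sumrN /= sumrB.
rewrite -(pair_bigA _ (fun i j => P i j * (i == k)%:R)) /=.
rewrite -(pair_bigA _ (fun i j => P i j * (j == k)%:R)) /=.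
congr (_ - _).
  rewrite (bigD1 k) //= [X in _ + X]big1 ?addr0 => [|i /negPf ik].
    by apply: eq_bigr => j _; rewrite eqxx mulr1.
  by apply: big1 => j _; rewrite ik mulr0.
apply: eq_bigr => i _; rewrite (bigD1 k) //= eqxx mulr1 big1 ?addr0 //.
by move=> j /negPf->; rewrite mulr0.
Qed.

(** The fibres of a monotone [b] are intervals. In the doubled difference an index strictly between
    [k] and [l] counts 2, each endpoint counts 1, and all others cancel. *)
Lemma rhoB_mono_pairs (k l : 'I_n) : (k < l)%N -> b k = b l ->
  let r := rho R (pair_label true false @: mono_pairs) in
  r 0 k - r 0 l = l%:R - k%:R.
Proof.
move=> kl bkl r; have two : (2 : R[i]) != 0 by rewrite pnatr_eq0.
apply: (mulfI two); rewrite mulrBr !rho_mono_pairs -sumrB.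
transitivity (\sum_(j < n) ((j < l.+1)%N%:R - (j < k.+1)%N%:R +
    ((j < l)%N%:R - (j < k)%N%:R) : R[i])).
  apply: eq_bigr => j _.
  set A := (k < j)%N && _; set B := (j < k)%N && _.
  set C := (l < j)%N && _; set D := (j < l)%N && _.
  have := @b_homo j k; have := @b_homo k j; have := @b_homo j l;
    have := @b_homo l j.
  move=> h1 h2 h3 h4.
  have : (A + D + (j < k.+1) + (j < k) = (j < l.+1) + (j < l) + B + C)%N.
    by rewrite /A /B /C /D; lia.
  move/(congr1 (fun m => m%:R : R[i])); rewrite !natrD => ABCD.
  apply: (@addIr _ (B%:R + C%:R + (j < k.+1)%N%:R + (j < k)%N%:R)).
  by apply: etrans (etrans _ ABCD) _; ring.
rewrite big_split !sumrB /= -!natr_sum !sum_ltn_ord //; try by rewrite ltnW.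
by rewrite -(natr1 l) -(natr1 k); ring.
Qed.

Lemma weyl_poly_mono_pairs x :
  weyl_poly (pair_label true false @: mono_pairs) x =
  \prod_(e in mono_pairs) (x 0 e.2 - x 0 e.1) /
  ((-1) ^+ #|mono_pairs| * \prod_(e in mono_pairs) (e.2%:R - e.1%:R)).
Proof.
rewrite /weyl_poly big_imset; last by move=> e e' _ _ /pair_label_inj.
rewrite -prodrN -prodfV -big_split; apply: eq_bigr => e.
rewrite inE => /andP[lt /eqP be].
rewrite /pair_label !dotC_rootv expr0 expr1 !mul1r !mulN1r rhoB_mono_pairs //.
by rewrite /= invrN mulrN -mulNr opprB.
Qed.

End Monotone.

End Labels.

(** * The roots of [h_p] by block and the value of the constant *)

Section RealForm.
Variables (R : realType) (p q : nat).
Local Notation n := (p + (1 + q))%N.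
Local Notation block := (@block_index p q).
Local Notation E := (cross_pairs p q).
Local Notation h := (h_p R n p).
Local Notation C := R[i].
Implicit Types (x lam : 'rV[C]_n).

Definition block_pairs (c d : nat) : {set 'I_n * 'I_n} :=
  [set e : 'I_n * 'I_n | (block e.1 == c) && (block e.2 == d)].

Lemma h_pE k : h 0 k = 1 - (block k)%:R.
Proof.
rewrite mxE /block_index.
by case: ltngtP => // _; rewrite ?subr0 ?subrr // [(_ + _)%N]/= mulr2n opprD addNKr.
Qed.

(** An integer copy of the pairing with [h_p], so that the descriptions of root sets below reduce to
    [lia]. *)
Definition root_value (i j : 'I_n) (m t : bool) : int :=
  (-1) ^+ t * ((1 - (block i)%:Z) + (-1) ^+ m * (1 - (block j)%:Z)).

Lemma root_valueE i j m t :
  dotC (rootv R (i, j, m, t)) h = (root_value i j m t)%:~R.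
Proof.
rewrite dotCC dotC_rootv !h_pE /root_value.
by case: m; case: t; rewrite ?expr0 ?expr1 ?mul1r ?mulN1r ?(intrN, intrD, intrB).
Qed.

Lemma l_pos_noncompactE :
  l_pos_noncompact_roots h = pair_label false false @: block_pairs 0 2.
Proof.
apply/setP => -[[[i j] m] t]; rewrite mem_pair_label !in_set root_valueE intr_eq0 /=.
rewrite /root_value /block_index.
by case: m; case: t; rewrite ?andbF //= ?andbT ?mul1r; lia.
Qed.

Lemma l_pos_compactE :
  l_pos_compact_roots h = pair_label true false @: inner_pairs p q.
Proof.
apply/setP => -[[[i j] m] t]; rewrite mem_pair_label !in_set root_valueE intr_eq0 /=.
rewrite /root_value /block_index.
by case: m; case: t; rewrite ?andbF //= ?andbT ?mul1r; lia.
Qed.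

(** Two coordinates of [h_p] add up to 1 only as [1 + 0], and to -1 only as [0 + (-1)]; the latter
    calls for the negative root. *)
Lemma p1E : p1_roots h =
  (pair_label false false @: block_pairs 0 1) :|:
  (pair_label false true @: block_pairs 1 2).
Proof.
apply/setP => -[[[i j] m] t].
rewrite in_setU !mem_pair_label !in_set root_valueE (eqr_int _ _ 1) /=.
rewrite /root_value /block_index.
by case: m; case: t; rewrite ?andbF //= ?andbT ?mul1r; lia.
Qed.

Lemma pos_compactE :
  pos_compact_roots n = pair_label true false @: mono_pairs (fun _ : 'I_n =>
    0%N).
Proof.
apply/setP => -[[[i j] m] t]; rewrite mem_pair_label !in_set /=.
by case: m; case: t; rewrite ?andbF //= ?andbT.
Qed.

Lemma card_block_pairs01 : #|block_pairs 0 1| = p.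
Proof.
rewrite -sum1_card big_mkcond (eq_bigr (fun e : 'I_n * 'I_n =>
  nat_of_bool ((block e.1 == 0%N) && (block e.2 == 1%N)))); last first.
  by move=> e _; rewrite inE; case: andP.
rewrite (@sum_blocks p q (fun a b =>
  nat_of_bool ((a == 0%N) && (b == 1%N)))) /=.
by lia.
Qed.

Definition inner_pairs0 : {set 'I_n * 'I_n} :=
  [set e : 'I_n * 'I_n | (e.1 < e.2)%N && (block e.2 == 0%N)].

Lemma card_inner_pairs0 : #|inner_pairs0| = 'C(p, 2).
Proof.
pose f (e : 'I_p * 'I_p) : 'I_n * 'I_n := (lshift (1 + q) e.1, lshift (1 + q) e.2).
have fI : injective f by move=> [i j] [i' j'] [/val_inj -> /val_inj ->].
rewrite -card_ltn_pairs -(card_imset _ fI); apply: eq_card => -[i j].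
rewrite inE; apply/andP/imsetP => [[/= ij bj]|[[i' j']]].
  have jp : (j < p)%N by move: bj; rewrite /block_index; lia.
  exists (Ordinal (ltn_trans ij jp), Ordinal jp); first by rewrite inE.
  by congr (_, _); apply: val_inj.
by rewrite inE /= => ij [-> ->]; rewrite blockE.
Qed.

(** The sum is invariant under the block-preserving transposition of [i] and [j]. *)
Lemma block_pairs_sum_const c d i j : block i = block j ->
  (\sum_(e in block_pairs c d) pair_sum C e) 0 i =
  (\sum_(e in block_pairs c d) pair_sum C e) 0 j.
Proof.
move=> bij; have hH : tperm i j \in block_perms p q.
  by apply/block_permsP => k; case: tpermP => // ->.
set S := \sum_(e in _) _.
have hS : col_perm (tperm i j) S = S.
  have BH : pair_perm (tperm i j) @: block_pairs c d = block_pairs c d.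
    exact: (pair_perm_stable (fun a b => (a == c) && (b == d)) hH).
  rewrite /S -[in LHS]BH big_imset /=; last by move=> e e' _ _ /pair_perm_inj.
  rewrite raddf_sum; apply: eq_bigr => e _; exact: col_perm_pair_sum.
by rewrite -[in LHS]hS mxE tpermL.
Qed.

Lemma block_vdm_translate x (w : 'rV[C]_n) :
  (forall i j, block i = block j -> w 0 i = w 0 j) ->
  block_vdm (x - w) = block_vdm x.
Proof.
move=> wc; apply: eq_bigr => e; rewrite inE => /andP[_ /eqP be].
by rewrite !mxE (wc _ _ be); ring.
Qed.

Lemma P_K_E x : P_K x = vdm x *
  ((-1) ^+ 'C(n, 2) * vdm (nat_row C (@nat_of_ord n)))^-1.
Proof.
rewrite /P_K pos_compactE weyl_poly_mono_pairs //.
have mE : mono_pairs (fun _ : 'I_n =>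
  0%N) = [set e : 'I_n * 'I_n | (e.1 < e.2)%N].
  by apply/setP => e; rewrite !inE andbT.
rewrite mE card_ltn_pairs; congr (_ / (_ * _)).
  by apply: eq_bigl => e; rewrite inE.
by apply: eq_big => [e|e _]; rewrite ?inE // !mxE.
Qed.

Lemma block_rankK k :
  (block_rank k + ((0 < block k) * p + (1 < block k)))%N = k.
Proof. by rewrite /block_rank /block_index; lia. Qed.

(** Within a block, differences of indices are differences of ranks, so the denominator is, up to
    sign, [block_vdm] at the very point where [G V] is evaluated. *)
Lemma P_LK_E x : P_LK h x = block_vdm x *
  ((-1) ^+ #|inner_pairs p q| * block_vdm (nat_row C (@block_rank p q)))^-1.
Proof.
rewrite /P_LK l_pos_compactE (weyl_poly_mono_pairs (@block_homo p q)).
congr (_ / (_ * _)); apply: eq_bigr => e; rewrite inE => /andP[_ /eqP be].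
by rewrite !mxE -[in LHS](block_rankK e.1) -[in LHS](block_rankK e.2) be !natrD; ring.
Qed.

Lemma block_vdm_rank_neq0 : block_vdm (nat_row C (@block_rank p q)) != 0.
Proof.
apply/prodf_neq0 => e; rewrite inE => /andP[lt /eqP be].
rewrite !mxE subr_eq0 eqr_nat; apply: contraTN lt => /eqP re.
by rewrite -(block_rankK e.1) -(block_rankK e.2) re be ltnn.
Qed.

(** The pairs between blocks 0 and 2 come from the sum over [A], the others from the sum over
    [C]. *)
Lemma cross_pairsE :
  E = block_pairs 0 2 :|: (block_pairs 0 1 :|: block_pairs 1 2).
Proof.
apply/setP => e; rewrite !inE.
by move: (block_lt3 e.1) (block_lt3 e.2); case: (block e.1) => [|[|[|]]] //;
  case: (block e.2) => [|[|[|]]].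
Qed.

Hypotheses (p_even : ~~ odd p) (q_even : ~~ odd q).

(** Positive values occur on the [p q + p + q] compact roots across blocks, on ['C(p, 2)] sums
    inside the first block and on [p] sums with the middle coordinate. Modulo 2 only
    ['C(p, 2) = r (2 r - 1)] remains, with [r = p./2]. *)
Lemma odd_N_h : odd (N_h h) = odd p./2.
Proof.
rewrite /N_h (_ : [set _ in _ | _] = pair_label true false @: E :|:
    (pair_label false false @: inner_pairs0 :|:
     pair_label false false @: block_pairs 0 1)).
  rewrite !cardsU !(card_imset _ (@pair_label_inj _ _ _)).
  rewrite (_ : _ :&: (_ :|: _) = set0); last first.
    apply/setP => -[[[i j] m] t];
      rewrite in_setI in_setU !mem_pair_label in_set0.
    by case: m; rewrite /= ?andbF.
  rewrite (_ : _ :&: _ = set0); last first.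
    apply/setP => -[[[i j] m] t];
      rewrite in_setI !mem_pair_label in_set0 !in_set /=.
    by case: m; case: t => //=; case: eqP => [->|]; rewrite ?andbF.
  rewrite card_cross_pairs card_inner_pairs0 card_block_pairs01 cards0 !subn0.
  have := bin2_double p.
  have p2 : p = (2 * p./2)%N by lia.
  have q2 : q = (2 * q./2)%N by lia.
  have : (p * p = 4 * (p./2 * p./2))%N by rewrite {1 2}p2; lia.
  have : (p * q = 4 * (p./2 * q./2))%N by rewrite {1}p2 {1}q2; lia.
  by lia.
apply/setP => -[[[i j] m] t].
rewrite !in_setU !mem_pair_label !in_set root_valueE ltr0z /=.
rewrite /root_value /block_index.
by case: m; case: t; rewrite ?andbF //= ?andbT ?mul1r; lia.
Qed.

Lemma alternating_sum_h_p lam :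
  alternating_sum h lam =
  (-1) ^+ p./2 * ('C(p./2 + q./2, p./2))%:R * P_LK h lam.
Proof.
rewrite alternating_sumE l_pos_noncompactE p1E.
set mu := lam - _; set PK := @P_K R n.
have dis12 : [disjoint block_pairs 0 1 & block_pairs 1 2].
  by rewrite -setI_eq0; apply/eqP/setP => e; rewrite !inE; lia.
(* The roots of blocks 0 and 1 enter negated; [diff_opN] reverses them with the shift [w] and the
   sign [(-1) ^+ p = 1]. Those of blocks 1 and 2 are negative roots, so their translations are
   already positive. *)
pose w := \sum_(e in block_pairs 0 1) pair_sum C e.
have step x : diff_op ((pair_label false false @: block_pairs 0 1) :|:
      (pair_label false true @: block_pairs 1 2)) (fun a => - rootv R a) PK x =
    diff_op (block_pairs 0 1 :|: block_pairs 1 2) (@pair_sum C p q) PK (x - w).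
  rewrite diff_opU; last first.
    rewrite -setI_eq0; apply/eqP/setP => -[[[i j] m] t].
    by rewrite in_setI !mem_pair_label in_set0; case: t; rewrite /= ?andbF.
  rewrite diff_op_imset; last exact: pair_label_inj.
  rewrite (eq_diff_op (v' := fun e => - pair_sum C e)
     (f' := diff_op (block_pairs 1 2) (@pair_sum C p q) PK)); last first.
  - move=> y; rewrite diff_op_imset; last exact: pair_label_inj.
    apply: eq_diff_op => // e _; rewrite /= expr0 expr1 scale1r scaleN1r.
    by rewrite opprK.
  - by move=> e _; rewrite /= !expr0 !scale1r.
  by rewrite diff_opN card_block_pairs01 -signr_odd (negPf p_even) mul1r diff_opU.
rewrite diff_op_imset; last exact: pair_label_inj.
rewrite (eq_diff_op (v' := @pair_sum C p q) (f' := fun x =>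
   diff_op (block_pairs 0 1 :|: block_pairs 1 2) (@pair_sum C p q) PK (x - w))) //; last first.
  by move=> e _; rewrite /= !expr0 !scale1r.
rewrite diff_op_translate -diff_opU; last first.
  by rewrite -setI_eq0; apply/eqP/setP => e; rewrite !inE; lia.
rewrite -cross_pairsE.
rewrite (eq_diff_op (v' := @pair_sum C p q) _ _ P_K_E) // diff_op_scale.
have [k Hk] := diff_op_vdm C p q.
have := diff_op_block_rank C p_even q_even; rewrite !Hk => kE.
have rhoE : rho R (pair_label false false @: block_pairs 0 2) =
    2^-1 *: \sum_(e in block_pairs 0 2) pair_sum C e.
  rewrite /rho big_imset /=; last by move=> e e' _ _ /pair_label_inj.
  by congr (_ *: _); apply: eq_bigr => e _; rewrite /= !expr0 !scale1r.
(* The accumulated shift is constant on each block, so the inner differences do not see it. *)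
rewrite /mu -addrA -opprD block_vdm_translate; last first.
  move=> i j bij; rewrite rhoE.
  have addE (u v : 'rV[C]_n) l : (2^-1 *: u + v) 0 l = 2^-1 * u 0 l + v 0 l.
    by rewrite !mxE.
  by rewrite !addE /w !(block_pairs_sum_const _ _ bij).
rewrite P_LK_E -[in LHS]signr_odd odd_N_h signr_odd -card_inner_pairs exprD.
(* The signs of the two Weyl denominators differ by this factor. *)
have -> : (-1) ^+ #|E| = 1 :> C.
  rewrite card_cross_pairs -signr_odd !oddD oddM.
  by rewrite (negPf p_even) (negPf q_even).
have Vnz : vdm (nat_row C (@nat_of_ord n)) != 0 by apply/vdm_nat_neq0/val_inj.
have Bnz := block_vdm_rank_neq0.
rewrite !invfM invr1 mulr1 -[k](mulfK Bnz) kE.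
move: Vnz; move: (vdm _) (block_vdm lam) (block_vdm _)^-1 (_%:R) => V B b c.
by move: ((-1) ^+ p./2) ((-1) ^- _) => sg t Vnz; field.
Qed.

End RealForm.

(* "The constant is v": c satisfies the defining identity exactly when c = v. *)
Theorem theorem8p18 (R : realType) (n p : nat)
    (n_ge1 : (1 <= n)%N) (n_odd : odd n)
    (p_even : ~~ odd p) (p_le : (p <= n - 1)%N) :
  let r := (p %/ 2)%N in
  let s := ((n - 1 - p) %/ 2)%N in
  forall c : R[i],
    is_constant_of (h_p R n p) c <->
    c = (-1) ^+ (p %/ 2)%N * ('C(r + s, r))%:R.
Proof.
move=> r s c; rewrite /r /s !divn2.
have [q nE] : exists q, n = (p + (1 + q))%N by exists (n - 1 - p)%N; lia.
have -> : (n - 1 - p)%N = q by lia.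
have q_even : ~~ odd q by lia.
move: n_ge1 n_odd p_le; rewrite nE => _ _ _.
split=> [cE|-> lam]; last exact: alternating_sum_h_p.
(* [P_LK] does not vanish at the rank point, so the identity there determines [c]. *)
have /eqP := cE (nat_row R[i] (@block_rank p q)).
rewrite (alternating_sum_h_p p_even q_even) eq_sym.
have Pnz : P_LK (h_p R (p + (1 + q)) p) (nat_row R[i] (@block_rank p q)) != 0.
  by rewrite P_LK_E mulf_neq0 ?invr_eq0 ?mulf_neq0 ?signr_eq0 ?block_vdm_rank_neq0.
by move/eqP/(mulIf Pnz).
Qed.
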